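(* Let $t\ge 1$ be an integer and let $u\in S=K[x_1,\dots,x_n]$ be a $t$-spread monomial. Then all the powers of $B_t(u)$ have linear quotients. In particular, all the powers of $B_t(u)$ have a linear resolution.
   Context: $K$ is a field, $S=K[x_1,\dots,x_n]$. For a monomial $w$, $\operatorname{supp}(w)=\{j: x_j\mid w\}$; for a monomial ideal $I$, $G(I)$ denotes its unique minimal set of monomial generators. A monomial ideal $L$ has linear quotients if the elements of $G(L)$ can be ordered $w_1,\dots,w_m$ so that for each $2\le j\le m$ the colon ideal $(w_1,\dots,w_{j-1}):w_j$ is generated by a subset of the variables $x_1,\dots,x_n$. For an integer $t\ge 1$, a monomial $x_{i_1}\cdots x_{i_d}\in S$ with $i_1\le\cdots\le i_d$ is called $t$-spread if $i_j-i_{j-1}\ge t$ for $2\le j\le d$. A $t$-spread monomial ideal is an ideal generated by $t$-spread monomials. A $t$-spread monomial ideal $I$ is $t$-spread strongly stable if for all $w\in G(I)$, $j\in\operatorname{supp}(w)$ and $i<j$ such that $x_i(w/x_j)$ is $t$-spread, one has $x_i(w/x_j)\in I$. For a $t$-spread monomial $u=x_{i_1}\cdots x_{i_d}$, $B_t(u)$ denotes the smallest $t$-spread strongly stable ideal containing $u$ (the $t$-spread principal Borel ideal of $u$). Explicitly, $G(B_t(u))$ consists of the monomials $x_{j_1}\cdots x_{j_d}$ with $j_k\le i_k$ for $1\le k\le d$ and $j_k-j_{k-1}\ge t$ for $2\le k\le d$. *)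

(* Defs.v *)
From mathcomp Require Import all_boot all_order all_algebra.
From mathcomp.multinomials Require Import mpoly.

Set Implicit Arguments.
Unset Strict Implicit.
Unset Printing Implicit Defensive.

Import GRing.Theory.
Local Open Scope ring_scope.

(* The polynomial ring is S = {mpoly K[n]}; its variables are indexed by 'I_n,
   i.e. by 0, ..., n-1.  Monomials are exponent vectors w : 'X_{1..n}, and
   'X_[w] is w as an element of S.  Ideals are predicates S -> Prop, compared
   with [ideal_eq]. *)

Section Ideals.

Variables (K : fieldType) (n : nat).
Local Notation S := {mpoly K[n]}.

Definition ideal_eq (I J : S -> Prop) : Prop := forall f, I f <-> J f.

Definition ideal_gen (A : S -> Prop) : S -> Prop := fun f =>
  exists2 s : seq (S * S),
    (forall p, p \in s -> A p.2) & f = \sum_(p <- s) p.1 * p.2.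

Definition ideal_pow (I : S -> Prop) (k : nat) : S -> Prop :=
  ideal_gen (fun f =>
    exists2 g : 'I_k -> S, (forall i, I (g i)) & f = \prod_(i < k) g i).

Definition monomial_ideal (M : 'X_{1..n} -> Prop) : S -> Prop :=
  ideal_gen (fun f => exists2 w, M w & f = 'X_[w]).

Definition variable_ideal (A : {set 'I_n}) : S -> Prop :=
  ideal_gen (fun f => exists2 i, i \in A & f = 'X_i).

Definition colon (I : S -> Prop) (g : S) : S -> Prop := fun f => I (f * g).

(* M = G(I).  For a monomial ideal I there is exactly one such set M. *)
Definition is_min_gens (I : S -> Prop) (M : 'X_{1..n} -> Prop) : Prop :=
  ideal_eq I (monomial_ideal M) /\
  forall N : 'X_{1..n} -> Prop, (forall w, N w -> M w) ->
    ideal_eq I (monomial_ideal N) -> forall w, M w -> N w.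

Definition has_linear_quotients (L : S -> Prop) : Prop :=
  exists ws : seq 'X_{1..n},
    [/\ uniq ws,
        is_min_gens L (fun w => w \in ws) &
        forall j, (0 < j < size ws)%N ->
          exists A : {set 'I_n},
            ideal_eq
              (colon (monomial_ideal (fun w => w \in take j ws))
                     'X_[nth 0%MM ws j])
              (variable_ideal A)].

(* A finite graded free resolution of I of the form
     0 -> S(-d-p)^(b p) -> ... -> S(-d-1)^(b 1) -> S(-d)^(b 0) -> I -> 0.
   Elements of S^(b k) are column vectors.  The augmentation is a row [e] of
   forms of degree d.  A homogeneous map S(-d-k-1)^(b k.+1) -> S(-d-k)^(b k)
   is a matrix [D k] of linear forms (0 is a form of every degree).  Such a
   resolution is automatically minimal, as no entry of [D k] is a nonzero
   constant. *)
Definition has_d_linear_resolution (d : nat) (I : S -> Prop) : Prop :=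
  exists (p : nat) (b : nat -> nat) (e : 'rV[S]_(b 0%N))
         (D : forall k, 'M[S]_(b k, b k.+1)),
    (forall k, (p < k)%N -> b k = 0%N) /\
    [/\ (forall j, e 0 j \is d.-homog),
        (forall k i j, D k i j \is 1.-homog),
        (forall f, I f <-> exists v : 'cV[S]_(b 0%N), (e *m v) 0 0 = f),
        (forall v : 'cV[S]_(b 0%N),
           e *m v = 0 <-> exists w : 'cV[S]_(b 1%N), D 0%N *m w = v) &
        (forall k (v : 'cV[S]_(b k.+1)),
           D k *m v = 0 <-> exists w : 'cV[S]_(b k.+2), D k.+1 *m w = v)].

Definition has_linear_resolution (I : S -> Prop) : Prop :=
  exists d, has_d_linear_resolution d I.

End Ideals.

Definition t_spread (n t : nat) (w : 'X_{1..n}) : Prop :=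
  exists2 s : seq 'I_n,
    sorted (fun i j : 'I_n => (i + t <= j)%N) s &
    w = (\sum_(i <- s) U_(i))%MM.

Section Borel.

Variables (K : fieldType) (n : nat).
Local Notation S := {mpoly K[n]}.

Definition t_spread_ideal (t : nat) (I : S -> Prop) : Prop :=
  exists2 M : 'X_{1..n} -> Prop,
    (forall w, M w -> t_spread t w) & ideal_eq I (monomial_ideal M).

(* (U_(j) <= w)%MM says that x_j divides w, and U_(i) + (w - U_(j)) is
   x_i (w / x_j). *)
Definition t_spread_strongly_stable (t : nat) (I : S -> Prop) : Prop :=
  t_spread_ideal t I /\
  forall M, is_min_gens I M ->
  forall (w : 'X_{1..n}) (i j : 'I_n),
    M w -> (U_(j) <= w)%MM -> (i < j)%N ->
    t_spread t (U_(i) + (w - U_(j)))%MM ->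
    I 'X_[U_(i) + (w - U_(j))].

(* The smallest t-spread strongly stable ideal containing u, as the
   intersection of all of them. *)
Definition principal_borel (t : nat) (u : 'X_{1..n}) : S -> Prop := fun f =>
  forall I : S -> Prop, t_spread_strongly_stable t I -> I 'X_[u] -> I f.

End Borel.

Arguments principal_borel K {n} t u _.

(* Main.v *)
(* Write F_w(a) for the sum of the exponents of w at the variables of index
   < a.  G(B_t(u)^k) consists of the monomials w of degree k deg u with
   F_w >= k F_u whose exponents sum to at most k on every window of t
   consecutive variables; such a w is the product, over c < k, of the t-spread
   monomials with prefix sums floor((F_w + c) / k).

   If w < v lexicographically in this set, let a be the first index where they
   differ and j the first index of supp(w) beyond a.  On a window that contains a
   but not j, the monomial w has a smaller exponent sum than v, as they agree
   before a, w_a < v_a and w has no support strictly between a and j; so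
   x_a w / x_j still lies in the set.  It is larger than w and divides x_a w, and
   x_a divides v / gcd(v, w).  Hence the decreasing lexicographic order gives
   linear quotients.

   A linear resolution then arises by iterated mapping cones: if I is d-linear,
   f is a form of degree d and I : f is 1-linear, then I + (f) is d-linear.
   Ideals of variables are instances, since (x_1, ..., x_(i-1)) : x_i is
   (x_1, ..., x_(i-1)), so no Koszul complex is needed. *)

Require Import Defs.
From mathcomp Require Import all_boot all_order all_algebra.
From mathcomp.multinomials Require Import mpoly.
From mathcomp Require Import zify.
From Stdlib Require Import Classical ClassicalEpsilon.

Set Implicit Arguments.
Unset Strict Implicit.
Unset Printing Implicit Defensive.

Import Order.TTheory GRing.Theory.
Local Open Scope ring_scope.

(** * Homogeneous components and lifts through homogeneous matrices *)

Section Homogeneous.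

Variables (K : fieldType) (n : nat).
Local Notation S := {mpoly K[n]}.

Lemma pihomogM c d (p q : S) : p \is c.-homog ->
  pihomog mdeg (c + d) (p * q) = p * pihomog mdeg d q.
Proof.
move=> hp; rewrite {1}[q]mpolyE mulr_sumr raddf_sum /= [pihomog _ d q]pihomogE.
rewrite mulr_sumr [RHS]big_mkcond /=; apply: eq_bigr => m _.
rewrite -scalerAr linearZ /=.
have hX : p * 'X_[m] \is (c + mdeg m).-homog by rewrite dhomogM // dhomogX.
case: eqP => [<-|/eqP ne]; first by rewrite pihomog_dE // -scalerAr.
rewrite (pihomog_ne0 (d := (c + mdeg m)%N)) ?scaler0 //.
by rewrite eqn_add2l.
Qed.

Definition homog_mx d p q (A : 'M[S]_(p, q)) := forall i j, A i j \is d.-homog.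

Lemma mulmx_homog c d p q r (A : 'M[S]_(p, q)) (B : 'M[S]_(q, r)) :
  homog_mx c A -> homog_mx d B -> homog_mx (c + d) (A *m B).
Proof. by move=> hA hB i j; rewrite mxE rpred_sum // => k _; apply: dhomogM. Qed.

(** Arbitrary preimages of the columns of [B] suffice: since [A] is homogeneous, their components of
    degree [d] are still preimages. *)
Lemma homog_lift c d p q r (A : 'M[S]_(p, q)) (B : 'M[S]_(p, r)) :
    homog_mx c A -> homog_mx (c + d) B ->
    (forall j, exists v : 'cV_q, A *m v = col j B) ->
  exists2 X : 'M[S]_(q, r), homog_mx d X & A *m X = B.
Proof.
move=> hA hB hcol.
pose v j := sval (constructive_indefinite_description _ (hcol j)).
have hv j : A *m v j = col j B by rewrite /v; case: constructive_indefinite_description.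
exists (\matrix_(i, j) pihomog mdeg d (v j i 0)) => [i j|].
  by rewrite mxE; apply: pihomogP.
apply/matrixP => i j; have /matrixP/(_ i 0) := hv j.
rewrite !mxE => /(congr1 (pihomog mdeg (c + d))).
rewrite (pihomog_dE (hB i j)) raddf_sum /= => <-.
by apply: eq_bigr => k _; rewrite mxE pihomogM.
Qed.

End Homogeneous.

(** * Mapping cones of linear resolutions *)

Section MappingCone.

Variables (K : fieldType) (n : nat).
Local Notation S := {mpoly K[n]}.

Lemma linear_resolution_eq d (I J : S -> Prop) : ideal_eq I J ->
  has_d_linear_resolution d I -> has_d_linear_resolution d J.
Proof.
move=> eqIJ [p [b [e [D [hp [he hD hI h0 hk]]]]]].
exists p, b, e, D; split=> //; split=> // f.
by rewrite -hI; split=> /eqIJ.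
Qed.

Lemma linear_resolution0 d (I : S -> Prop) :
  (forall f, I f <-> f = 0) -> has_d_linear_resolution d I.
Proof.
move=> hI; exists 0%N, (fun=> 0%N), 0, (fun=> 0); split=> //; split.
- by case.
- by move=> k [].
- move=> f; rewrite hI; split=> [->|[v <-]]; last by rewrite mul0mx mxE.
  by exists 0; rewrite mul0mx mxE.
- by move=> v; split=> _; [exists 0 | rewrite mul0mx]; rewrite ?[v]flatmx0 ?mulmx0.
- by move=> k v; split=> _; [exists 0 | rewrite mul0mx]; rewrite ?[v]flatmx0 ?mulmx0.
Qed.

Definition exact_at p q r (A : 'M[S]_(p, q)) (B : 'M[S]_(q, r)) :=
  forall v : 'cV_q, A *m v = 0 <-> exists w : 'cV_r, B *m w = v.

Lemma exact_mul0 p q r (A : 'M[S]_(p, q)) (B : 'M[S]_(q, r)) :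
  exact_at A B -> A *m B = 0.
Proof.
move=> ex; apply/matrixP => i j.
have /matrixP/(_ i 0) : A *m col j B = 0.
  by apply/ex; exists (delta_mx j 0); rewrite colE.
by rewrite !mxE => h; rewrite -[RHS]h; apply: eq_bigr => k _; rewrite [in RHS]mxE.
Qed.

(** With the augmentation counted as map number 0, the complex resolves S/I and comparison maps
    begin on S itself. *)
Definition aug_rank (b : nat -> nat) k := if k is k'.+1 then b k' else 1%N.

Definition aug_mx (b : nat -> nat) (e : 'rV[S]_(b 0%N))
    (D : forall k, 'M[S]_(b k, b k.+1)) k :
    'M[S]_(aug_rank b k, aug_rank b k.+1) :=
  match k with 0 => e | k'.+1 => D k' end.

(** Degrees of the entries of the augmented complex; the comparison maps follow the same pattern. *)
Definition cone_degree d k := if k is _.+1 then 1%N else d.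

(** The comparison theorem for complexes, with the sign that makes the block matrices of the mapping
    cone compose to zero. The last hypothesis starts the recursion; exactness of [D] continues
    it. *)
Lemma chain_lift (d : nat) (b c : nat -> nat)
    (D : forall k, 'M[S]_(b k, b k.+1)) (E : forall k, 'M[S]_(c k, c k.+1))
    (f : 'M[S]_(b 0%N, c 0%N)) :
    (forall k, homog_mx (cone_degree d k) (D k)) ->
    (forall k, homog_mx 1 (E k)) ->
    (forall k, exact_at (D k) (D k.+1)) -> (forall k, E k *m E k.+1 = 0) ->
    homog_mx d f ->
    (forall v : 'cV_(c 1%N), exists w : 'cV_(b 1%N), D 0%N *m w = f *m E 0%N *m v) ->
  exists psi : forall k, 'M[S]_(b k, c k),
    [/\ psi 0%N = f, forall k, homog_mx (cone_degree d k) (psi k) &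
        forall k, D k *m psi k.+1 = - (psi k *m E k)].
Proof.
move=> hD hE exD EE hf img.
(* The second conjunct guarantees that the next lift exists, so that lifts can be chosen
   recursively. *)
pose ok k (g : 'M[S]_(b k, c k)) := homog_mx (cone_degree d k) g /\
  forall v : 'cV_(c k.+1), exists w : 'cV_(b k.+1), D k *m w = g *m E k *m v.
have step k (g : {g | @ok k g}) :
    exists h : {h | @ok k.+1 h}, D k *m sval h = - (sval g *m E k).
  case: g => g [hg imgg] /=.
  have [||j|h hh Dh] :=
      @homog_lift K n (cone_degree d k) 1 _ _ _ (D k) (- (g *m E k)).
  - exact: hD.
  - by move=> i j; rewrite mxE rpredN; apply: mulmx_homog.
  - have [w Dw] := imgg (- delta_mx j 0); exists w.
    by rewrite Dw mulmxN colE mulNmx.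
  have okh : @ok k.+1 h.
    split=> // v; have [|w Dw] := (exD k (h *m E k.+1 *m v)).1; last by exists w.
    by rewrite !mulmxA Dh mulNmx -(mulmxA g) EE mulmx0 oppr0 mul0mx.
  by exists (exist _ h okh).
pose next k g := sval (constructive_indefinite_description _ (step k g)).
have nextP k g : D k *m sval (next k g) = - (sval g *m E k).
  by rewrite /next; case: constructive_indefinite_description.
pose psi := fix psi k : {g | @ok k g} :=
  match k with 0 => exist _ f (conj hf img) | k'.+1 => next k' (psi k') end.
exists (fun k => sval (psi k)); split=> // k; last exact: nextP.
by case: (psi k) => g [].
Qed.

Lemma block_homog d p1 p2 q1 q2 (A : 'M[S]_(p1, q1)) (B : 'M[S]_(p1, q2))
    (C : 'M[S]_(p2, q1)) (D : 'M[S]_(p2, q2)) :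
  homog_mx d A -> homog_mx d B -> homog_mx d C -> homog_mx d D ->
  homog_mx d (block_mx A B C D).
Proof.
move=> hA hB hC hD i j; rewrite !mxE.
by case: (split i) => i'; rewrite !mxE; case: (split j).
Qed.

(** For a cycle (x, s), exactness of the second complex gives s = E2 w, and then x - psi2 w is a
    cycle of the first. *)
Lemma cone_exact p0 p1 p2 q0 q1 q2 (D1 : 'M[S]_(p0, p1)) (D2 : 'M[S]_(p1, p2))
    (E1 : 'M[S]_(q0, q1)) (E2 : 'M[S]_(q1, q2))
    (psi1 : 'M[S]_(p0, q1)) (psi2 : 'M[S]_(p1, q2)) :
    exact_at D1 D2 -> exact_at E1 E2 -> D1 *m psi2 = - (psi1 *m E2) ->
  exact_at (block_mx D1 psi1 0 E1) (block_mx D2 psi2 0 E2).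
Proof.
move=> exD exE comm v; split=> [|[w <-]]; last first.
  rewrite mulmxA mulmx_block (exact_mul0 exD) (exact_mul0 exE) comm.
  by rewrite !mul0mx !mulmx0 !addr0 addNr block_mx0 mul0mx.
rewrite -[v]vsubmxK; move: (usubmx v) (dsubmx v) => x s.
rewrite mul_block_col mul0mx add0r -col_mx0 => /eq_col_mx[Dx Es].
have [w Ew] := (exE s).1 Es.
have [|y Dy] := (exD (x - psi2 *m w)).1.
  by rewrite mulmxBr mulmxA comm mulNmx opprK -mulmxA Ew.
by exists (col_mx y w); rewrite mul_block_col mul0mx add0r Dy Ew subrK.
Qed.

(** At the bottom end no row records that s is a cycle, so its lift is a hypothesis; the colon ideal
    will supply it. *)
Lemma cone_exact0 p0 p1 p2 q1 q2 (D1 : 'M[S]_(p0, p1)) (D2 : 'M[S]_(p1, p2))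
    (E2 : 'M[S]_(q1, q2)) (psi1 : 'M[S]_(p0, q1)) (psi2 : 'M[S]_(p1, q2)) :
    exact_at D1 D2 -> D1 *m psi2 = - (psi1 *m E2) ->
    (forall x s, D1 *m x + psi1 *m s = 0 -> exists w : 'cV_q2, E2 *m w = s) ->
  exact_at (row_mx D1 psi1) (block_mx D2 psi2 0 E2).
Proof.
move=> exD comm hs v; split=> [|[w <-]]; last first.
  rewrite mulmxA mul_row_block (exact_mul0 exD) comm.
  by rewrite mulmx0 addr0 addNr row_mx0 mul0mx.
rewrite -[v]vsubmxK; move: (usubmx v) (dsubmx v) => x s.
rewrite mul_row_col => Dx; have [w Ew] := hs _ _ Dx.
have [|y Dy] := (exD (x - psi2 *m w)).1.
  by rewrite mulmxBr mulmxA comm mulNmx opprK -mulmxA Ew.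
by exists (col_mx y w); rewrite mul_block_col mul0mx add0r Dy Ew subrK.
Qed.

(** Multiplication by [f] embeds S/(I : f) into S/I with cokernel S/(I + (f)), so the cone of its
    lift to the resolutions resolves that cokernel. The lift is [f] on S and linear above, so the
    cone stays linear. *)
Lemma linear_resolution_cone d (I : S -> Prop) (f : S) :
    has_d_linear_resolution d I -> f \is d.-homog ->
    has_d_linear_resolution 1 (colon I f) ->
  has_d_linear_resolution d (fun g => exists2 h, I h & exists s, g = h + s * f).
Proof.
move=> [p [b [e [D [hp [he hD hI h0 hk]]]]]] hf.
move=> [p' [b' [e' [D' [hp' [he' hD' hI' h0' hk']]]]]].
pose B := aug_mx e D; pose E := aug_mx e' D'.
have exB k : exact_at (B k) (B k.+1) by case: k.
have exE k : exact_at (E k) (E k.+1) by case: k.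
have [||||v|psi [psi0 hpsi comm]] :=
    @chain_lift d _ _ B E f%:M _ _ exB.
- by case=> [|k] i j; rewrite ?ord1 /=; [apply: he | apply: hD].
- by case=> [|k] i j; rewrite ?ord1 /=; [apply: he' | apply: hD'].
- by move=> k; apply: exact_mul0.
- by move=> i j; rewrite !ord1 mxE.
- have /hI[w ew] : colon I f ((e' *m v) 0 0) by apply/hI'; exists v.
  exists w; rewrite -mulmxA mul_scalar_mx; apply/matrixP => i j.
  by rewrite !ord1 /= ew !mxE mulrC.
(* The second summand is [b'] moved up by one place, with rank 1 for the generator [f] at place 0;
   hence the extra successor in the length. *)
exists (maxn p p').+1, (fun k => aug_rank b k.+1 + aug_rank b' k)%N.
exists (row_mx (B 0%N) (psi 0%N)).
exists (fun k => block_mx (B k.+1) (psi k.+1) 0 (E k)).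
split=> [[|k] //|].
  by rewrite ltnS gtn_max => /andP[pk pk'] /=; rewrite hp ?hp' // ltnW.
split.
- move=> j; rewrite mxE psi0; case: (split j) => j'; rewrite ?mxE ?ord1 //=.
- move=> k; rewrite -/(homog_mx 1 _); apply: block_homog => [||i j|].
  + by move=> i j; apply: hD.
  + exact: (hpsi k.+1).
  + by rewrite mxE rpred0.
  + by case: k => [|k] i j; rewrite ?ord1 /=; [apply: he' | apply: hD'].
- move=> g; split=> [[h /hI[v ev] [s ->]]|[v <-]].
    exists (col_mx v s%:M); rewrite mul_row_col psi0 mul_scalar_mx !mxE /=.
    by rewrite -ev mxE mulr1n mulrC.
  exists ((e *m usubmx v) 0 0); first by apply/hI; eexists.
  exists (dsubmx v 0 0); rewrite -{1}[v]vsubmxK mul_row_col psi0 mul_scalar_mx.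
  by rewrite !mxE mulrC.
(* A syzygy (x, s) of the new generators gives s f = - e x in I, so s lies in I : f. *)
- apply: cone_exact0 (exB 0%N) (comm 0%N) _ => x s; rewrite psi0 => xs0.
  have /hI'[w ew] : colon I f (s 0 0).
    apply/hI; exists (- x); move/matrixP/(_ 0 0): xs0.
    rewrite mul_scalar_mx mulmxN !mxE mulrC => /eqP; rewrite addr_eq0 => /eqP.
    by move=> ->; rewrite opprK.
  by exists w; apply/matrixP => i j; rewrite !ord1.
- by move=> k; apply: cone_exact; [apply: exB | apply: exE | apply: comm].
Qed.

End MappingCone.

(** * Monomial ideals, their colons and minimal generators *)

Section MonomialIdeals.

Variables (K : fieldType) (n : nat).
Local Notation S := {mpoly K[n]}.
Implicit Types (A I J : S -> Prop) (M N : 'X_{1..n} -> Prop).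

Lemma ideal_eq_sym I J : ideal_eq I J -> ideal_eq J I.
Proof. by move=> eqIJ f; rewrite eqIJ. Qed.

Lemma ideal_gen_ind A (P : S -> Prop) : P 0 ->
    (forall f g, P f -> P g -> P (f + g)) ->
    (forall a f, A f -> P (a * f)) ->
  forall f, ideal_gen A f -> P f.
Proof.
move=> P0 PD PA f [s hs ->]; elim: s hs => [|p s IHs] hs; first by rewrite big_nil.
rewrite big_cons; apply: PD; first by apply: PA; apply: hs; rewrite mem_head.
by apply: IHs => q qs; apply: hs; rewrite inE qs orbT.
Qed.

Lemma ideal_gen0 A : ideal_gen A 0.
Proof. by exists [::]; rewrite ?big_nil. Qed.

Lemma ideal_genD A f g : ideal_gen A f -> ideal_gen A g -> ideal_gen A (f + g).
Proof.
move=> [s hs ->] [s' hs' ->]; exists (s ++ s'); last by rewrite big_cat.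
by move=> p; rewrite mem_cat => /orP[/hs|/hs'].
Qed.

Lemma ideal_gen_sum A (T : eqType) (r : seq T) (F : T -> S) :
  (forall x, x \in r -> ideal_gen A (F x)) -> ideal_gen A (\sum_(x <- r) F x).
Proof.
move=> h; rewrite big_seq; elim/big_rec: _ => [|x f xr hf]; first exact: ideal_gen0.
by apply: ideal_genD => //; apply: h.
Qed.

Lemma ideal_genM A a f : ideal_gen A f -> ideal_gen A (a * f).
Proof.
move=> [s hs ->]; exists [seq (a * p.1, p.2) | p <- s].
  by move=> _ /mapP[p /hs Ap ->].
by rewrite big_map mulr_sumr; apply: eq_bigr => p _; rewrite mulrA.
Qed.

Lemma ideal_gen_sub A f : A f -> ideal_gen A f.
Proof.
move=> Af; exists [:: (1, f)]; last by rewrite big_seq1 mul1r.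
by move=> p; rewrite inE => /eqP->.
Qed.

Lemma ideal_gen_le A B : (forall f, A f -> ideal_gen B f) ->
  forall f, ideal_gen A f -> ideal_gen B f.
Proof.
move=> AB; apply: ideal_gen_ind => [|f g|a f /AB]; first exact: ideal_gen0.
  exact: ideal_genD.
exact: ideal_genM.
Qed.

Lemma monomial_idealP M (f : S) : monomial_ideal M f <->
  forall m, m \in msupp f -> exists2 w, M w & (w <= m)%MM.
Proof.
split.
  move: f; apply: ideal_gen_ind => [m|f g hf hg m|a _ [w Mw ->] m].
  - by rewrite msupp0.
  - by move/msuppD_le; rewrite mem_cat => /orP[/hf|/hg].
  move/msuppM_le => /allpairsP[[m1 m2] /= [_]].
  by rewrite msuppX inE => /eqP-> ->; exists w => //; apply: lem_addl.
move=> h; rewrite [f]mpolyE; apply: ideal_gen_sum => m /h[w Mw wm].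
rewrite -(submK wm) mpolyXD scalerAl; apply/ideal_genM/ideal_gen_sub.
by exists w.
Qed.

Lemma monomial_idealX M m :
  monomial_ideal M ('X_[m] : S) <-> exists2 w, M w & (w <= m)%MM.
Proof.
rewrite monomial_idealP msuppX; split=> [|h m']; first by apply; rewrite inE.
by rewrite inE => /eqP->.
Qed.

Lemma monomial_ideal_le M N :
    (forall w, M w -> exists2 v, N v & (v <= w)%MM) ->
  forall f : S, monomial_ideal M f -> monomial_ideal N f.
Proof. by move=> MN; apply: ideal_gen_le => _ [w /MN h ->]; apply/monomial_idealX. Qed.

Lemma monomial_ideal_ext M N :
  (forall w, M w <-> N w) -> ideal_eq (monomial_ideal M : S -> Prop) (monomial_ideal N).
Proof.
move=> MN f; split; apply: monomial_ideal_le => w h; exists w; rewrite ?lepm_refl //.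
  exact/MN.
exact/MN.
Qed.

Lemma colon_monomialP M w (f : S) : colon (monomial_ideal M) 'X_[w] f <->
  forall m, m \in msupp f -> exists2 v, M v & (v <= m + w)%MM.
Proof.
rewrite /colon monomial_idealP; split=> h m hm.
  by apply: h; rewrite (perm_mem (msuppMX _ _)) addmC map_f.
move: hm; rewrite (perm_mem (msuppMX _ _)) => /mapP[m' /h hm' ->].
by rewrite addmC.
Qed.

Lemma monomial_ideal_add M w :
  ideal_eq (fun g : S => exists2 h, monomial_ideal M h & exists s, g = h + s * 'X_[w])
           (monomial_ideal (fun m => m = w \/ M m) : S -> Prop).
Proof.
move=> f; split=> [[h Mh [s ->]]|].
  apply: ideal_genD; last by apply/ideal_genM/ideal_gen_sub; exists w; [left|].
  by move: h Mh; apply: monomial_ideal_le => m Mm; exists m; [right | rewrite lepm_refl].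
move: f; apply: ideal_gen_ind => [|f g [h Mh [s ->]] [h' Mh' [s' ->]]|a _ [m [->|Mm] ->]].
- by exists 0; [apply: ideal_gen0 | exists 0; rewrite mul0r addr0].
- by exists (h + h'); [apply: ideal_genD | exists (s + s'); rewrite mulrDl addrACA].
- by exists 0; [apply: ideal_gen0 | exists a; rewrite add0r].
exists (a * 'X_[m]); first by apply/ideal_genM/ideal_gen_sub; exists m.
by exists 0; rewrite mul0r addr0.
Qed.

Lemma variable_ideal_monomial (V : {set 'I_n}) :
  ideal_eq (variable_ideal V : S -> Prop)
           (monomial_ideal (fun m => m \in [seq U_(i)%MM | i <- enum V])).
Proof.
move=> f; split; apply: ideal_gen_le => g.
  move=> [i iV ->]; apply: ideal_gen_sub; exists U_(i)%MM => //.
  by rewrite map_f // mem_enum.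
move=> [_ /mapP[i iV ->] ->]; apply: ideal_gen_sub; exists i => //.
by rewrite -mem_enum.
Qed.

Lemma linear_resolution_add d M w : mdeg w = d ->
    has_d_linear_resolution d (monomial_ideal M : S -> Prop) ->
    has_d_linear_resolution 1 (colon (monomial_ideal M) 'X_[w] : S -> Prop) ->
  has_d_linear_resolution d (monomial_ideal (fun m => m = w \/ M m) : S -> Prop).
Proof.
move=> dw resM resC; apply: linear_resolution_eq (monomial_ideal_add M w) _.
by apply: linear_resolution_cone; rewrite // dhomogX; apply/eqP.
Qed.

Lemma linear_resolution_nil d :
  has_d_linear_resolution d (monomial_ideal (fun m => m \in [::]) : S -> Prop).
Proof.
apply: linear_resolution0 => f; split=> [|->]; last exact: ideal_gen0.
move/monomial_idealP => h; apply: msuppnil0.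
by case: (msupp f) h => // m s /(_ m); rewrite mem_head => -[].
Qed.

Lemma linear_resolution_variables (V : {set 'I_n}) :
  has_d_linear_resolution 1 (variable_ideal V : S -> Prop).
Proof.
apply: linear_resolution_eq (ideal_eq_sym (variable_ideal_monomial V)) _.
elim: (enum V) (enum_uniq V) => [_|i s IHs /= /andP[is_s /IHs ress]].
  exact: linear_resolution_nil.
have := @linear_resolution_add 1 _ U_(i)%MM (mdeg1 i) ress.
move/(_ _)/(linear_resolution_eq (monomial_ideal_ext _)); apply.
  by move=> w; rewrite inE; split=> [[->|->]|/predU1P[]]; rewrite ?eqxx ?orbT; auto.
apply: linear_resolution_eq ress => f.
rewrite colon_monomialP monomial_idealP; split=> h m /h[v vs vm]; exists v => //.
  by apply: lepm_trans vm (lem_addr _ _).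
case/mapP: vs vm => j js ->; rewrite !lep1mP mnmDE mnm1E.
by case: (i =P j) => [ij|]; [rewrite ij js in is_s | rewrite addn0].
Qed.

Lemma linear_quotients_resolution d (ws : seq 'X_{1..n}) :
    (forall w, w \in ws -> mdeg w = d) ->
    (forall j, (0 < j < size ws)%N -> exists V : {set 'I_n},
       ideal_eq (colon (monomial_ideal (fun w => w \in take j ws)) 'X_[nth 0%MM ws j])
                (variable_ideal V : S -> Prop)) ->
  has_d_linear_resolution d (monomial_ideal (fun w => w \in ws) : S -> Prop).
Proof.
move=> degw quot; suff res j : (j <= size ws)%N ->
    has_d_linear_resolution d (monomial_ideal (fun w => w \in take j ws) : S -> Prop).
  by have := res _ (leqnn _); rewrite take_size.
elim: j => [_|j IHj ltj].
  by rewrite take0; apply: linear_resolution_nil.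
have := linear_resolution_add (degw _ (mem_nth 0%MM ltj)) (IHj (ltnW ltj)).
move/(_ _)/(linear_resolution_eq (monomial_ideal_ext _)); apply.
  move=> w; rewrite (take_nth 0%MM) // mem_rcons inE.
  by split=> [[->|->]|/predU1P[]]; rewrite ?eqxx ?orbT; auto.
(* The hypothesis on colons starts at the second generator; for the first one, the zero ideal has
   zero colon by a monomial. *)
case: j {IHj} ltj => [|j] ltj.
  apply: linear_resolution0 => f; rewrite colon_monomialP take0.
  split=> [h|-> m]; last by rewrite msupp0.
  by apply: msuppnil0; case: (msupp f) h => // m s /(_ m); rewrite mem_head => -[].
have [|V eqV] := quot j.+1; first by rewrite ltj.
exact: linear_resolution_eq (ideal_eq_sym eqV) (linear_resolution_variables V).
Qed.

Lemma lem_mdeg_eq (v w : 'X_{1..n}) : (v <= w)%MM -> mdeg v = mdeg w -> v = w.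
Proof.
move=> le_vw; rewrite -{1 2}(submK le_vw) mdegD => /eqP.
by rewrite -[X in X == _]add0n eqn_add2r eq_sym mdeg_eq0 => /eqP->; rewrite add0m.
Qed.

(** No monomial properly divides another of the same degree, so no generator can be spared. *)
Lemma equigenerated_min_gens d (I : S -> Prop) M :
    (forall w, M w -> mdeg w = d) -> ideal_eq I (monomial_ideal M) ->
  is_min_gens I M.
Proof.
move=> degM eqI; split=> // N NM eqN w Mw.
have /eqN/monomial_idealX[v Nv le_vw] : I 'X_[w].
  by apply/eqI/monomial_idealX; exists w; rewrite ?lepm_refl.
by rewrite -(lem_mdeg_eq le_vw) // !degM //; apply: NM.
Qed.

(** If a proper divisor of [w] lay in the ideal, a generator other than [w] would divide it, and [w]
    could be dropped. *)
Lemma min_gens_unique (I : S -> Prop) M w :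
  is_min_gens I M -> M w -> forall v, I 'X_[v] -> (v <= w)%MM -> v = w.
Proof.
move=> [eqI minM] Mw v /eqI/monomial_idealX[v' Mv' le_v'v] le_vw.
have [eq_v'w|ne_v'w] := eqVneq v' w.
  apply/mnmP => i; apply/eqP; rewrite eqn_leq (mnm_lepP le_vw) -{1}eq_v'w.
  exact: (mnm_lepP le_v'v).
have [_ /(_ erefl)//] : M w /\ w <> w.
apply: (minM (fun m => M m /\ m <> w)) Mw => [m []//|f].
split=> [/eqI|h]; last first.
  apply/eqI; move: f h; apply: monomial_ideal_le => m [Mm _].
  by exists m; rewrite ?lepm_refl.
move: f; apply: monomial_ideal_le => m Mm; have [->|ne_mw] := eqVneq m w.
  exists v'; last exact: lepm_trans le_vw.
  by split=> //; apply/eqP.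
by exists m; rewrite ?lepm_refl //; split=> //; apply/eqP.
Qed.

(** The elements of [M] minimal for divisibility work: induction on the degree finds one below each
    element of [M]. *)
Lemma min_gens_exist (I : S -> Prop) M : ideal_eq I (monomial_ideal M) ->
  exists N, is_min_gens I N.
Proof.
move=> eqI; pose N w := M w /\ forall v, M v -> (v <= w)%MM -> v = w.
have below w : M w -> exists2 v, N v & (v <= w)%MM.
  have [d] := ubnP (mdeg w); elim: d w => // d IHd w ltd Mw.
  have [Nw|nNw] := classic (N w); first by exists w; rewrite ?lepm_refl.
  have [v [Mv le_vw ne_vw]] : exists v, [/\ M v, (v <= w)%MM & v <> w].
    apply: NNPP => no; apply: nNw; split=> // v Mv le_vw.
    by apply: NNPP => ne_vw; apply: no; exists v.
  have [|v' Nv' le_v'v] := IHd v _ Mv; last by exists v'; rewrite ?(lepm_trans le_v'v).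
  rewrite -ltnS (leq_trans _ ltd) // ltnS -(submK le_vw) mdegD -add1n leq_add2r.
  rewrite lt0n mdeg_eq0; apply/eqP => vw0; apply: ne_vw.
  by rewrite -(submK le_vw) vw0 add0m.
have eqN : ideal_eq I (monomial_ideal N).
  move=> f; rewrite eqI; split; apply: monomial_ideal_le => w; first exact: below.
  by case=> Mw _; exists w; rewrite ?lepm_refl.
exists N; split=> // N' subN eqN' w [Mw minw].
have /eqN'/monomial_idealX[v N'v le_vw] : I 'X_[w].
  by apply/eqI/monomial_idealX; exists w; rewrite ?lepm_refl.
by rewrite -(minw v) //; case: (subN v N'v).
Qed.

Lemma monomial_ideal_mul M N P (f g : S) :
    (forall v w, M v -> N w -> P (v + w)%MM) ->
  monomial_ideal M f -> monomial_ideal N g -> monomial_ideal P (f * g).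
Proof.
move=> MNP /monomial_idealP hf /monomial_idealP hg; apply/monomial_idealP => m.
move/msuppM_le/allpairsP => [[m1 m2] /= [/hf[v Mv v1] /hg[w Nw w2] ->]].
exists (v + w)%MM; first exact: MNP.
by apply/mnm_lepP => i; rewrite !mnmDE leq_add // (mnm_lepP v1, mnm_lepP w2).
Qed.

End MonomialIdeals.

(** * Prefix sums, windows and the exchange of variables *)

Section PrefixSums.

Variable n : nat.
Implicit Types (u v w : 'X_{1..n}) (i j : 'I_n).
Local Open Scope nat_scope.

Definition prefix w a := \sum_(i < n | i < a) w i.

Lemma prefix0 w : prefix w 0 = 0.
Proof. by rewrite /prefix big_pred0. Qed.

Lemma prefixD v w a : prefix (v + w) a = prefix v a + prefix w a.
Proof. by rewrite -big_split; apply: eq_bigr => i _; rewrite mnmDE. Qed.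

Lemma prefix_sum (T : Type) (r : seq T) (F : T -> 'X_{1..n}) a :
  prefix (\sum_(x <- r) F x)%MM a = \sum_(x <- r) prefix (F x) a.
Proof.
rewrite /prefix exchange_big /=; apply: eq_bigr => i _; exact: mnm_sumE.
Qed.

Lemma prefixU i a : prefix U_(i) a = (i < a).
Proof.
rewrite /prefix big_mkcond (bigD1 i) //= mnm1E eqxx big1 => [|j].
  by rewrite addn0; case: ifP.
by rewrite mnm1E eq_sym => /negPf->; case: ifP.
Qed.

Lemma prefixS w i : prefix w i.+1 = prefix w i + w i.
Proof.
rewrite /prefix (bigD1 i) //= addnC; congr addn.
by apply: eq_bigl => j; rewrite ltnS -val_eqE /=; lia.
Qed.

Lemma prefix_min w a : prefix w (minn a n) = prefix w a.
Proof. by apply: eq_bigl => i; rewrite leq_min ltn_ord andbT. Qed.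

Lemma prefix_mdeg w a : n <= a -> prefix w a = mdeg w.
Proof.
move=> le_na; rewrite mdegE /prefix; apply: eq_bigl => i.
exact: leq_trans (ltn_ord i) le_na.
Qed.

Lemma prefix_leq w a b : a <= b -> prefix w a <= prefix w b.
Proof.
move=> le_ab; rewrite /prefix [X in X <= _]big_mkcond [X in _ <= X]big_mkcond.
apply: leq_sum => i _.
by case: ltnP => // lt_ia; rewrite (leq_trans lt_ia).
Qed.

Lemma prefix_agree v w a b : (forall i, i < a -> v i = w i) -> b <= a ->
  prefix v b = prefix w b.
Proof.
by move=> eq_vw le_ba; apply: eq_bigr => i lt_ib; rewrite eq_vw // (leq_trans lt_ib).
Qed.

Lemma prefix_gap w a b : (forall i, a <= i < b -> w i = 0) -> a <= b ->
  prefix w b = prefix w a.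
Proof.
move=> gap le_ab; rewrite /prefix [LHS]big_mkcond [RHS]big_mkcond; apply: eq_bigr => i _.
case: (ltnP i a) => [lt_ia|le_ai]; first by rewrite (leq_trans lt_ia).
by case: ltnP => // lt_ib; rewrite gap ?le_ai.
Qed.

Lemma prefix_inj v w : (forall a, prefix v a = prefix w a) -> v = w.
Proof.
move=> eq_vw; apply/mnmP => i; apply/eqP.
by rewrite -(eqn_add2l (prefix v i)) -prefixS eq_vw prefixS eq_vw.
Qed.

(** Taking first differences inverts prefix sums; as [f] is nondecreasing, the truncated subtraction
    loses nothing. *)
Lemma prefix_diff (f : nat -> nat) a : f 0 = 0 -> (forall b, f b <= f b.+1) ->
  prefix [multinom f i.+1 - f i | i < n] a = f (minn a n).
Proof.
move=> f0 fS; rewrite -prefix_min; have: minn a n <= n by rewrite geq_minr.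
elim: (minn a n) => [_|b IHb ltb]; first by rewrite prefix0.
by rewrite (prefixS _ (Ordinal ltb)) IHb ?(ltnW ltb) // mnmE subnKC.
Qed.

Definition windowed t k w := forall a, prefix w (a + t) <= prefix w a + k.

Lemma windowed_le t k v w : (v <= w)%MM -> windowed t k w -> windowed t k v.
Proof.
move=> le_vw win a; have := win a; rewrite -(submK le_vw) !prefixD.
have := prefix_leq (w - v)%MM (leq_addr t a); lia.
Qed.

(** A window of length [t] meets a t-spread list at most once. Conversely the increasing enumeration
    of the support works: two indices less than [t] apart, or a repeated one, would overfill a
    window. *)
Lemma t_spreadP t w : 0 < t -> t_spread t w <-> windowed t 1 w.
Proof.
move=> t_gt0; split=> [[s sorted_s ->] a|win].
  rewrite !prefix_sum; elim: s sorted_s => [|i s IHs] /= s_path.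
    by rewrite !big_nil.
  rewrite !big_cons !prefixU; have := IHs (path_sorted s_path).
  have [lt_ia|le_ai _] := ltnP i a; first by case: (i < a + t) => /=; lia.
  rewrite (eq_big_seq (fun=> 0)) => [|j js].
    by rewrite big_const_seq iter_fix //; case: (_ < _); lia.
  rewrite prefixU; have : i + t <= j.
    have tr : transitive (fun i j : 'I_n => i + t <= j) by move=> x y z; lia.
    by have /allP/(_ _ js) := order_path_min tr s_path.
  by move=> le_ij; case: ltnP => //; lia.
have w1 i : w i <= 1.
  have := win i; have := prefixS w i.
  have /(prefix_leq w) : i.+1 <= i + t by lia.
  lia.
exists [seq i <- enum 'I_n | w i != 0].
  have /= : sorted (fun i j : 'I_n => i < j) [seq i <- enum 'I_n | w i != 0].
    apply: sorted_filter; first by move=> x y z; lia.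
    by have := iota_ltn_sorted 0 n; rewrite -val_enum_ord sorted_map.
  apply: (sub_in_sorted (P := fun i => w i != 0)); last by rewrite filter_all.
  move=> i j; rewrite -!topredE /= => wi wj lt_ij.
  rewrite leqNgt; apply/negP => lt_j.
  have := win i; have := prefixS w i; have := prefixS w j.
  have := prefix_leq w lt_ij; have := prefix_leq w lt_j; lia.
apply/mnmP => i; rewrite mnm_sumE big_filter big_enum_cond /= big_mkcond.
rewrite (bigD1 i) //= mnm1E eqxx big1 => [|j /negPf ne_ji].
  by have := w1 i; case: (w i) => [|[]].
by rewrite mnm1E ne_ji; case: ifP.
Qed.

(** With [j] the first support index of [w] beyond [a], the prefix sums of [w] are constant from a+1
    to j and lie below those of [v] there. This comparison serves the window bound and, later, the
    walk from [u] to a given generator. *)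
Lemma exchange t k v w (a : 'I_n) :
    mdeg v = mdeg w -> (forall i, i < a -> v i = w i) -> w a < v a ->
    windowed t k v -> windowed t k w ->
  exists j, [/\ a < j, 0 < w j,
    forall b, prefix (U_(a) + (w - U_(j))) b = prefix w b + (a < b <= j),
    forall b, a < b <= j -> prefix w b < prefix v b &
    windowed t k (U_(a) + (w - U_(j)))].
Proof.
move=> deg_vw eq_vw lt_wv win_v win_w.
have ltS : prefix w a.+1 < prefix v a.+1.
  by rewrite !prefixS (prefix_agree eq_vw) // ltn_add2l.
have [j0 P0|none] := pickP (fun j : 'I_n => (a < j) && (0 < w j)); last first.
  have := prefix_leq v (ltn_ord a); rewrite [prefix v n]prefix_mdeg // deg_vw.
  rewrite -(prefix_mdeg w (leqnn n)).
  rewrite (prefix_gap (a := a.+1)) => [|i /andP[lt_ai _]|]; first lia.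
    by have /negbT := none i; rewrite lt_ai /= -eqn0Ngt => /eqP.
  exact: ltn_ord.
case: (@arg_minnP _ j0 (fun j : 'I_n => (a < j) && (0 < w j)) (@nat_of_ord n) P0)
  => j /andP[lt_aj wj] min_j.
have gap b : a < b <= j -> prefix w b = prefix w a.+1.
  move=> /andP[lt_ab le_bj]; apply: prefix_gap => // i /andP[lt_ai lt_ib].
  apply/eqP; rewrite eqn0Ngt; apply/negP => wi.
  by have := min_j i; rewrite lt_ai wi => /(_ isT); lia.
have pre b : prefix (U_(a) + (w - U_(j))) b = prefix w b + (a < b <= j).
  have <- : prefix (w - U_(j)) b + (j < b) = prefix w b.
    by rewrite -prefixU -prefixD submK // lep1mP -lt0n.
  by rewrite prefixD prefixU; lia.
have lt_pre b : a < b <= j -> prefix w b < prefix v b.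
  move=> ab; rewrite gap //; apply: leq_trans ltS (prefix_leq _ _).
  by case/andP: ab.
exists j; split=> // b; rewrite !pre.
(* If the right end of the window gains one, so does the left end when a < b; when b is at most a,
   the bound comes from [v]. *)
have [/andP[lt_b le_b]|_] := boolP (a < b + t <= j); last by have := win_w b; lia.
have [lt_ab|le_ba] := ltnP a b; first by have := win_w b; lia.
have := win_v b; rewrite (prefix_agree eq_vw le_ba).
have := lt_pre (b + t); rewrite lt_b le_b => /(_ isT); lia.
Qed.

(** For k = 1 and t-spread [u], the prefix inequality says that the c-th index of [w] is at most
    that of [u] for every c, so these are the generators of B_t(u). *)
Definition borel_power t u k w :=
  [/\ mdeg w = k * mdeg u, forall a, k * prefix u a <= prefix w a & windowed t k w].

Lemma borel_power_exchange t u k v w :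
    borel_power t u k v -> borel_power t u k w -> (w < v)%O ->
  exists (a j : 'I_n), [/\ w a < v a, (U_(j) <= w)%MM,
    borel_power t u k (U_(a) + (w - U_(j)))%MM &
    (w < (U_(a) + (w - U_(j)))%MM)%O].
Proof.
move=> [deg_v low_v win_v] [deg_w low_w win_w].
have deg_vw : mdeg v = mdeg w by rewrite deg_v.
(* In equal degree the monomial order is lexicographic, and [a] is the first difference. *)
case/(ltmcP (esym deg_vw)) => a eq_wv lt_wv.
have [j [lt_aj wj pre _ win]] :=
  exchange deg_vw (fun i h => esym (eq_wv i h)) lt_wv win_v win_w.
have deg : mdeg (U_(a) + (w - U_(j))) = mdeg w.
  by rewrite -!(prefix_mdeg _ (leqnn n)) pre; have := ltn_ord j; lia.
exists a, j; split=> //; first by rewrite lep1mP -lt0n.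
  split=> [|b|//]; first by rewrite deg.
  by rewrite pre (leq_trans (low_w b)) ?leq_addr.
apply/ltmcP; rewrite ?deg //; exists a => [i lt_ia|].
  rewrite mnmDE mnmBE !mnm1E -!val_eqE /= (gtn_eqF lt_ia).
  by rewrite (gtn_eqF (ltn_trans lt_ia lt_aj)) subn0 add0n.
by rewrite mnmDE mnmBE !mnm1E eqxx -val_eqE /= (gtn_eqF lt_aj) subn0 add1n.
Qed.

(** Hermite's identity. Raising m by one shifts the summands and replaces floor(m/k) by floor(m/k) +
    1. *)
Lemma sum_shifted_div k m : 0 < k -> \sum_(c < k) (m + c) %/ k = m.
Proof.
case: k => // k _; elim: m => [|m IHm].
  by rewrite big1 // => c _; rewrite add0n divn_small.
rewrite big_ord_recr /= addSnnS divnDr ?dvdnn // divnn /= addnA addn1.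
congr _.+1; rewrite -[RHS]IHm big_ord_recl /= addn0 addnC.
by congr addn; apply: eq_bigr => c _; rewrite addSnnS.
Qed.

(** The factors multiply to [w] by Hermite's identity. An increase of at most k across a window
    raises each floor by at most 1, and since c < k, each factor has degree deg u. *)
Lemma borel_power_decomp t u k w : 0 < k -> borel_power t u k w ->
  exists2 g : 'I_k -> 'X_{1..n},
    forall c, borel_power t u 1 (g c) & w = (\sum_(c < k) g c)%MM.
Proof.
move=> k_gt0 [deg_w low_w win_w].
pose g (c : 'I_k) := [multinom (prefix w i.+1 + c) %/ k - (prefix w i + c) %/ k | i < n].
have pre c a : prefix (g c) a = (prefix w a + c) %/ k.
  rewrite (prefix_diff (f := fun a => (prefix w a + c) %/ k)) ?prefix_min //.
    by rewrite prefix0 add0n divn_small.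
  by move=> b; rewrite leq_div2r // leq_add2r prefix_leq.
exists g => [c|]; last first.
  apply: prefix_inj => a; rewrite prefix_sum -[LHS](sum_shifted_div _ k_gt0).
  by apply: eq_bigr => c _; rewrite pre.
split=> [|a|a].
- rewrite -!(prefix_mdeg _ (leqnn n)) pre prefix_mdeg // deg_w mul1n mulnC.
  by rewrite divnMDl // divn_small ?addn0 ?prefix_mdeg.
- by rewrite mul1n pre leq_divRL // mulnC (leq_trans (low_w a)) ?leq_addr.
rewrite !pre; have -> : (prefix w a + c) %/ k + 1 = (prefix w a + c + k) %/ k.
  by rewrite [RHS]divnDr ?dvdnn // divnn k_gt0.
by apply: leq_div2r; have := win_w a; lia.
Qed.

Lemma borel_powerD t u k l v w : borel_power t u k v -> borel_power t u l w ->
  borel_power t u (k + l) (v + w)%MM.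
Proof.
move=> [dv lv wv] [dw lw ww]; split=> [|a|a].
- by rewrite mdegD dv dw mulnDl.
- by rewrite prefixD mulnDl leq_add.
by rewrite !prefixD; have := wv a; have := ww a; lia.
Qed.

End PrefixSums.

(** * Listing monomials of one degree in decreasing order *)

Section DecreasingEnumeration.

Variable n : nat.
Implicit Types (v w : 'X_{1..n}) (ws : seq 'X_{1..n}).

Definition decreasing ws := sorted (fun v w => w < v)%O ws.

(** Monomials of bounded degree form a finite type, on which the predicate is decided
    classically. *)
Lemma decreasing_enum d (P : 'X_{1..n} -> Prop) :
    (forall w, P w -> mdeg w = d) ->
  exists ws, [/\ uniq ws, decreasing ws & forall w, w \in ws <-> P w].
Proof.
move=> degP; pose Pb w : bool := excluded_middle_informative (P w).
pose all_w := [seq bmnm m | m <- enum {: 'X_{1..n < d.+1}}].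
pose ws := [seq w <- all_w | Pb w].
have uniq_ws : uniq ws.
  by rewrite filter_uniq // map_inj_uniq ?enum_uniq //; apply: val_inj.
exists (rev (sort <=%O ws)); split=> [||w].
- by rewrite rev_uniq sort_uniq.
- rewrite /decreasing rev_sorted lt_sorted_uniq_le sort_uniq uniq_ws.
  exact: sort_le_sorted.
rewrite mem_rev mem_sort mem_filter /Pb; case: excluded_middle_informative => //= Pw.
split=> // _; apply/mapP.
have ltw : (mdeg w < d.+1)%N by rewrite degP.
by exists (BMultinom ltw); rewrite ?mem_enum.
Qed.

Lemma mem_take_decreasing ws j v : decreasing ws -> uniq ws -> (j < size ws)%N ->
  (v \in take j ws) = (v \in ws) && (nth 0%MM ws j < v)%O.
Proof.
move=> dec_ws uniq_ws ltj; have [v_ws|] := boolP (v \in ws); last first.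
  by apply: contraNF => /mem_take.
rewrite in_take //= -{1}(index_uniq 0%MM ltj uniq_ws).
have tr : transitive (fun v w => w < v)%O by move=> x y z xy yz; apply: lt_trans xy.
have wj := mem_nth 0%MM ltj.
apply/idP/idP => [|lt_wv]; first exact: (sorted_ltn_index tr dec_ws).
rewrite ltnNge leq_eqVlt; apply/negP => /orP[/eqP/(congr1 (nth 0%MM ws))|].
  by rewrite !nth_index // => eq_wv; rewrite eq_wv ltxx in lt_wv.
by move/(sorted_ltn_index tr dec_ws _ _ wj v_ws)/(lt_trans lt_wv); rewrite ltxx.
Qed.

End DecreasingEnumeration.

(** * Generators of the powers of B_t(u) and their linear quotients *)

Section PowersOfBorel.

Variables (K : fieldType) (n t : nat) (u : 'X_{1..n}).
Local Notation S := {mpoly K[n]}.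
Implicit Types (I : S -> Prop) (v w : 'X_{1..n}).
Hypothesis t_gt0 : (0 < t)%N.
Hypothesis spread_u : t_spread t u.

Lemma t_spread_ideal_le I v w : t_spread_ideal t I -> (v <= w)%MM ->
  I 'X_[v] -> I 'X_[w].
Proof.
move=> [M _ eqI] le_vw /eqI/monomial_idealX[m Mm le_mv].
by apply/eqI/monomial_idealX; exists m; rewrite ?(lepm_trans le_mv).
Qed.

(* Strong stability is only postulated for minimal generators; the move is
   applied to a generator dividing w. *)
Lemma strongly_stable_move I w (i j : 'I_n) :
    t_spread_strongly_stable t I -> I 'X_[w] -> (i < j)%N ->
    t_spread t (U_(i) + (w - U_(j)))%MM ->
  I 'X_[U_(i) + (w - U_(j))].
Proof.
move=> [spreadI stableI] Iw lt_ij spread_w'.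
have [M _ eqI] := spreadI; have [N minN] := min_gens_exist eqI.
have [eqN _] := minN; have /eqN/monomial_idealX[v Nv le_vw] := Iw.
have Iv : I 'X_[v] by apply/eqN/monomial_idealX; exists v; rewrite ?lepm_refl.
have [le_jv|nle_jv] := boolP (U_(j) <= v)%MM.
  have le_v'w' : (U_(i) + (v - U_(j)) <= U_(i) + (w - U_(j)))%MM.
    apply/mnm_lepP => x; rewrite !mnmDE !mnmBE leq_add2l leq_sub2r //.
    exact: (mnm_lepP le_vw).
  have spread_v' : t_spread t (U_(i) + (v - U_(j)))%MM.
    by apply/(t_spreadP _ t_gt0)/(windowed_le le_v'w')/(t_spreadP _ t_gt0).
  apply: t_spread_ideal_le spreadI le_v'w' _.
  exact: stableI N minN v i j Nv le_jv lt_ij spread_v'.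
(* If x_j does not divide [v], removing x_j from [w] leaves a multiple of [v]. *)
apply: (t_spread_ideal_le spreadI _ Iv); apply/mnm_lepP => x.
rewrite mnmDE mnmBE !mnm1E (leq_trans _ (leq_addl _ _)) //.
case: (j =P x) => [<-|_] /=; last by rewrite subn0 (mnm_lepP le_vw).
by move: nle_jv; rewrite lep1mP negbK => /eqP->.
Qed.

(** A walk from [u] to [w] by exchanges directed at [w]: each step stays t-spread, in the ideal and
    below [w] in prefix sums, and the total gap between the prefix sums drops, strictly so at
    a+1. *)
Lemma strongly_stable_borel I w :
    t_spread_strongly_stable t I -> I 'X_[u] -> borel_power t u 1 w ->
  I 'X_[w].
Proof.
move=> stableI; move: u spread_u => x.
have [N] := ubnP (\sum_(b < n.+1) (prefix w b - prefix x b)).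
elim: N x => // N IHN x ltN /(t_spreadP _ t_gt0) win_x Ix [deg_w low_w win_w].
rewrite mul1n in deg_w.
have {}low_w b : (prefix x b <= prefix w b)%N by have := low_w b; rewrite mul1n.
(* If [w] were the smaller one, its prefix sum just past the first difference would fall below that
   of [x]. *)
have [lt_wx|lt_xw|<-//] := ltgtP x w; last first.
  have /(ltmcP deg_w)[i eq_wx lt_i] := lt_xw.
  by have := low_w i.+1; rewrite !prefixS (prefix_agree eq_wx) // leq_add2l leqNgt lt_i.
have /(ltmcP (esym deg_w))[a eq_xw lt_a] := lt_wx.
have [j [lt_aj xj pre lt_pre win_x']] :=
  exchange deg_w (fun i h => esym (eq_xw i h)) lt_a win_w win_x.
have low_x' b : (prefix (U_(a) + (x - U_(j)))%MM b <= prefix w b)%N.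
  rewrite pre; have := low_w b; have := lt_pre b.
  by case: (a < b <= j)%N => [/(_ isT)|_] /=; lia.
have spread_x' : t_spread t (U_(a) + (x - U_(j)))%MM by apply/(t_spreadP _ t_gt0).
apply: (IHN (U_(a) + (x - U_(j)))%MM) => //.
- rewrite -ltnS (leq_trans _ ltN) // ltnS.
  pose b0 : 'I_n.+1 := Ordinal (ltn_ord a : (a.+1 < n.+1)%N).
  rewrite [X in (X < _)%N](bigD1 b0) //= [X in (_ < X)%N](bigD1 b0) //= -addSn.
  apply: leq_add; last by apply: leq_sum => b _; rewrite pre leq_sub2l ?leq_addr.
  rewrite pre leqnn lt_aj /=; have := lt_pre a.+1.
  by rewrite leqnn lt_aj => /(_ isT); lia.
- exact: strongly_stable_move.
split=> // [|b]; last by rewrite mul1n.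
rewrite mul1n deg_w -!(prefix_mdeg _ (leqnn n)) pre.
by have := ltn_ord j; lia.
Qed.

(** A minimal generator is divisible by some [v] in [borel_power] and equals it by minimality;
    lowering an index then only raises prefix sums. *)
Lemma borel_ideal_strongly_stable :
  t_spread_strongly_stable t (monomial_ideal (borel_power t u 1) : S -> Prop).
Proof.
split; first by exists (borel_power t u 1) => // w [_ _ win]; apply/(t_spreadP _ t_gt0).
move=> M minM w i j Mw le_jw lt_ij /(t_spreadP _ t_gt0) win'.
have [v Bv le_vw] : exists2 v, borel_power t u 1 v & (v <= w)%MM.
  apply/(monomial_idealX K); case: minM => eqM _; apply/eqM/monomial_idealX.
  by exists w; rewrite ?lepm_refl.
have Iv : monomial_ideal (borel_power t u 1) ('X_[v] : S).
  by apply/monomial_idealX; exists v; rewrite ?lepm_refl.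
have [deg_w low_w _] : borel_power t u 1 w by rewrite -(min_gens_unique minM Mw Iv).
apply/monomial_idealX; eexists; last exact: lepm_refl.
have pre b : (prefix (U_(i) + (w - U_(j)))%MM b + (j < b) = (i < b) + prefix w b)%N.
  by rewrite -!prefixU -!prefixD -addmA submK.
split=> // [|b]; last by have := pre b; have := low_w b; lia.
rewrite -deg_w -[in RHS](submK le_jw) !mdegD !mdeg1; lia.
Qed.

(** The candidate ideal is itself strongly stable and contains [u], so it bounds the intersection;
    conversely each candidate generator is forced. *)
Lemma principal_borelE :
  ideal_eq (principal_borel K t u) (monomial_ideal (borel_power t u 1)).
Proof.
move=> f; split=> [Bf|hf I stableI Iu].
  apply: Bf borel_ideal_strongly_stable _; apply/monomial_idealX.
  exists u; rewrite ?lepm_refl //; split=> [|a|]; rewrite ?mul1n //.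
  exact/(t_spreadP _ t_gt0).
have [[M _ eqI] _] := stableI; apply/eqI; move: f hf.
apply: ideal_gen_le => _ [w Bw ->].
by apply/(eqI 'X_[w]); apply: strongly_stable_borel Bw.
Qed.

Lemma monomial_ideal_prod k (g : 'I_k -> S) :
    (forall i, monomial_ideal (borel_power t u 1) (g i)) ->
  monomial_ideal (borel_power t u k) (\prod_(i < k) g i).
Proof.
elim: k g => [|k IHk] g hg.
  rewrite big_ord0 -mpolyX0; apply/monomial_idealX; exists 0%MM; rewrite ?lepm_refl //.
  split=> [|a|a]; first by rewrite mdeg0.
    by rewrite mul0n.
  by rewrite addn0 /prefix !big1 // => i _; rewrite mnm0E.
rewrite big_ord_recr /=; apply: monomial_ideal_mul (IHk _ _) (hg _) => // v w.
by rewrite -(addn1 k); apply: borel_powerD.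
Qed.

(** The defining bounds add up under products, which gives one inclusion; the floor decomposition
    gives the other. *)
Lemma borel_powE k : (0 < k)%N ->
  ideal_eq (ideal_pow (principal_borel K t u) k) (monomial_ideal (borel_power t u k)).
Proof.
move=> k_gt0 f; split; apply: ideal_gen_le => ? [].
  by move=> g hg ->; apply: monomial_ideal_prod => i; apply/principal_borelE.
move=> w /(borel_power_decomp k_gt0)[g Bg ->] ->; apply: ideal_gen_sub.
exists (fun c => 'X_[g c]) => [c|].
  by apply/principal_borelE/monomial_idealX; exists (g c); rewrite ?lepm_refl.
exact: (big_morph _ (@mpolyXD n K) (@mpolyX0 n K)).
Qed.

Lemma borel_power_quotients k ws :
    uniq ws -> decreasing ws -> (forall w, w \in ws <-> borel_power t u k w) ->
  forall j, (0 < j < size ws)%N -> exists V : {set 'I_n},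
    ideal_eq (colon (monomial_ideal (fun w => w \in take j ws)) 'X_[nth 0%MM ws j])
             (variable_ideal V : S -> Prop).
Proof.
move=> uniq_ws dec_ws memP j /andP[_ ltj]; set w := nth _ _ _.
(* These are all the variables lying in the colon ideal; the exchange shows that they generate
   it. *)
exists [set i | has (fun v => v <= U_(i) + w)%MM (take j ws)] => f.
rewrite colon_monomialP variable_ideal_monomial monomial_idealP.
split=> h m /h[v].
  rewrite mem_take_decreasing // => /andP[/memP Bv lt_wv] le_v.
  have Bw : borel_power t u k w by apply/memP/mem_nth.
  have [a [i [lt_a le_iw Bw' lt_ww']]] := borel_power_exchange Bv Bw lt_wv.
  exists U_(a)%MM.
    apply: map_f; rewrite mem_enum inE; apply/hasP.
    exists (U_(a) + (w - U_(i)))%MM; last first.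
      by apply/mnm_lepP => x; rewrite !mnmDE leq_add2l (mnm_lepP (lem_subr _ _)).
    by rewrite mem_take_decreasing //; apply/andP; split=> //; apply/memP.
  (* From w_a < v_a <= m_a + w_a it follows that x_a divides m. *)
  by have := mnm_lepP le_v a; rewrite lep1mP mnmDE; lia.
case/mapP=> i; rewrite mem_enum inE => /hasP[v' v'_ws le_v'] -> le_im.
exists v' => //; apply: lepm_trans le_v' _; apply/mnm_lepP => x.
by rewrite !mnmDE leq_add2r (mnm_lepP le_im).
Qed.

End PowersOfBorel.

Theorem proposition2p4 (K : fieldType) (n t : nat) (u : 'X_{1..n})
    (ht : (1 <= t)%N) (hu : t_spread t u) :
  (forall k : nat, (1 <= k)%N ->
     has_linear_quotients (ideal_pow (principal_borel K t u) k)) /\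
  (forall k : nat, (1 <= k)%N ->
     has_linear_resolution (ideal_pow (principal_borel K t u) k)).
Proof.
have deg k w : borel_power t u k w -> mdeg w = (k * mdeg u)%N by case.
have eqI k (ws : seq 'X_{1..n}) :
    (0 < k)%N -> (forall w, w \in ws <-> borel_power t u k w) ->
    ideal_eq (ideal_pow (principal_borel K t u) k) (monomial_ideal (fun w => w \in ws)).
  move=> k_gt0 memP f; rewrite (borel_powE ht hu k_gt0).
  by apply: monomial_ideal_ext => w; rewrite memP.
split=> k k_gt0; have [ws [uniq_ws dec_ws memP]] := decreasing_enum (deg k).
  exists ws; split=> //; last exact: borel_power_quotients memP.
  exact: equigenerated_min_gens (fun w h => deg k w ((memP w).1 h)) (eqI _ _ k_gt0 memP).
exists (k * mdeg u)%N.
apply: linear_resolution_eq (ideal_eq_sym (eqI k ws k_gt0 memP)) _.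
apply: linear_quotients_resolution => [w /memP/deg //|].
exact: borel_power_quotients memP.
Qed.
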